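(* Let $\mathcal{H}\subset\mathsf{E}$ be a crooked halfspace. Its groups of orientation-preserving affine, conformal and isometric automorphisms are respectively $$\mathsf{Aff}^+(\mathcal{H})\cong\mathbb{R}^3\rtimes\mathbb{Z}/2,\qquad \mathsf{Conf}^+(\mathcal{H})\cong\mathbb{R}^2\rtimes\mathbb{Z}/2,\qquad \mathsf{Isom}^+(\mathcal{H})\cong\mathbb{R}^1\rtimes\mathbb{Z}/2 .$$ Moreover the involutions (elements of order two) preserving $\mathcal{H}$ are reflections in tachyons orthogonal to the spine of $\mathcal{H}$; these preserve the orientation of $\mathsf{E}$ but reverse time-orientation.
   Context: $\mathsf{V}$ is an oriented real $3$-dimensional vector space with an inner product $\mathbf{u}\cdot\mathbf{v}$ of signature $(2,1)$ and a chosen time-orientation: one of the two components of the set of timelike vectors ($\mathbf{v}\cdot\mathbf{v}<0$) is selected and called $\mathsf{Future}$. A nonzero non-spacelike vector is future-pointing if it lies in the closure of $\mathsf{Future}$. $\mathsf{E}$ (Minkowski space) is an affine space with group of translations $\mathsf{V}$. A vector $\mathbf{s}$ is unit-spacelike if $\mathbf{s}\cdot\mathbf{s}=1$. For such $\mathbf{s}$, $\mathbf{s}^-,\mathbf{s}^+\in\mathbf{s}^\perp$ denote future-pointing null vectors with $\mathbf{s}^-\cdot\mathbf{s}^+=-1$ such that $(\mathbf{s},\mathbf{s}^-,\mathbf{s}^+)$ is a positively oriented basis of $\mathsf{V}$. For $p\in\mathsf{E}$ and $\mathbf{s}$ unit-spacelike, the (open) crooked halfspace with vertex $p$ and director $\mathbf{s}$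 is $$\mathcal{H}(p,\mathbf{s})=\{q: (q-p)\cdot\mathbf{s}^+<0,\ (q-p)\cdot\mathbf{s}>0\}\cup\{q:(q-p)\cdot\mathbf{s}^+<0,\ (q-p)\cdot\mathbf{s}^->0,\ (q-p)\cdot\mathbf{s}=0\}\cup\{q:(q-p)\cdot\mathbf{s}^->0,\ (q-p)\cdot\mathbf{s}<0\}.$$ Its spine is the line $p+\mathbb{R}\mathbf{s}$. $\mathsf{Aff}^+(\mathcal{H})$, $\mathsf{Conf}^+(\mathcal{H})$, $\mathsf{Isom}^+(\mathcal{H})$ are the groups of affine transformations $g$ of $\mathsf{E}$ with $g(\mathcal{H})=\mathcal{H}$ whose linear part lies, respectively, in $\mathsf{GL}^+(\mathsf{V})$ (positive determinant), in $\mathsf{SO}(2,1)\times\mathbb{R}^+$ (orientation-preserving linear isometries times positive homotheties), and in $\mathsf{SO}(2,1)$. A tachyon is an affine line with spacelike direction ($\mathbf{v}\cdot\mathbf{v}>0$). Reflection in a tachyon $L$ with direction $\mathbf{v}$ is the affine involution fixing $L$ pointwise and whose linear part is $-1$ on $\mathbf{v}^\perp$. In the semidirect products, the generator of $\mathbb{Z}/2$ acts on $\mathbb{R}^3$ by $(s,t,u)\mapsto(s,-t,u)$, on $\mathbb{R}^2$ by $(s,t)\mapsto(s,-t)$ and on $\mathbb{R}^1$ by $t\mapsto-t$. *)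

(* Defs.v *)
From HB Require Import structures.
From mathcomp Require Import all_boot all_order all_algebra.
From mathcomp Require Import all_classical all_reals all_analysis.
Import Order.TTheory GRing.Theory Num.Theory.
Import numFieldNormedType.Exports.

Set Implicit Arguments.
Unset Strict Implicit.
Unset Printing Implicit Defensive.

Local Open Scope classical_set_scope.
Local Open Scope ring_scope.

(* [orig] only witnesses non-emptiness; it also serves below as base point of
   the coordinates that topologize the affine group, a topology which does not
   depend on it. *)
Record affineSpace (V : zmodType) := AffineSpace {
  point :> Type;
  orig : point;
  shift : point -> V -> point;
  diff : point -> point -> V;
  shift0 : forall p, shift p 0 = p;
  shiftD : forall p u v, shift p (u + v) = shift (shift p u) v;
  shiftK : forall p v, diff (shift p v) p = v;
  diffK : forall p q, shift p (diff q p) = q }.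

Notation "p '+!' v" := (shift p v) (at level 50, left associativity).
Notation "q '-!' p" := (diff q p) (at level 50, left associativity).

(* V carries no topology in the library: topological notions are read through
   the coordinates in some basis, the choice of which is immaterial. *)
Definition vcoord (R : realType) (V : vectType R) (v : V) :
  'rV[R]_(\dim {:V}) := passmx.rVof (vbasis {:V}) v.
Arguments vcoord {R V} v.

Section AffineGroup.
Variables (R : realType) (V : vectType R) (E : affineSpace V).

Record affinity := Affinity {
  aff_fun :> E -> E;
  lin : 'End(V);
  aff_funP : forall q v, aff_fun (q +! v) = aff_fun q +! lin v;
  lin_inj : lker lin == 0%VS }.

Lemma affinity_eq (g h : affinity) : (forall q, g q = h q) -> g = h.
Proof.
case: g h => [g A gP Ai] [h B hP Bi] /= /funext gh; subst h.
have AB : A = B.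
  apply/lfunP => v; apply: etrans (shiftK (g (orig E)) (B v)).
  by rewrite -hP gP shiftK.
by subst B; congr Affinity; exact: Prop_irrelevance.
Qed.

Lemma aff1P q v : @id E (q +! v) = id q +! (\1%VF : 'End(V)) v.
Proof. by rewrite id_lfunE. Qed.

Lemma lker1 : lker (\1%VF : 'End(V)) == 0%VS.
Proof. by apply/lker0P => u v; rewrite !id_lfunE. Qed.

Definition aff_one := Affinity aff1P lker1.

Lemma affMP (g h : affinity) q v :
  (g \o h) (q +! v) = (g \o h) q +! (lin g \o lin h)%VF v.
Proof. by rewrite /= !aff_funP comp_lfunE. Qed.

Lemma lkerM (g h : affinity) : lker (lin g \o lin h)%VF == 0%VS.
Proof.
apply/lker0P => u v; rewrite !comp_lfunE.
by move=> /(lker0P (lin_inj g)) /(lker0P (lin_inj h)).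
Qed.

Definition aff_mul g h := Affinity (affMP g h) (lkerM g h).

Definition aff_inv_fun (g : affinity) (q : E) : E :=
  orig E +! (lin g)^-1%VF (q -! g (orig E)).

Lemma affVP (g : affinity) q v :
  aff_inv_fun g (q +! v) = aff_inv_fun g q +! ((lin g)^-1%VF : 'End(V)) v.
Proof.
rewrite /aff_inv_fun -shiftD -linearD; congr (_ +! (lin g)^-1%VF _).
apply: etrans (shiftK (g (orig E)) _).
by rewrite shiftD diffK.
Qed.

Lemma lkerV (g : affinity) : lker ((lin g)^-1%VF : 'End(V)) == 0%VS.
Proof. by apply/lker0P/(can_inj (lker0_lfunVK (lin_inj g))). Qed.

Definition aff_inv g := Affinity (affVP g) (lkerV g).

Lemma aff_mulA : associative aff_mul.
Proof. by move=> f g h; exact: affinity_eq. Qed.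
Lemma aff_mul1 : left_id aff_one aff_mul.
Proof. by move=> f; exact: affinity_eq. Qed.
Lemma aff_mulr1 : right_id aff_one aff_mul.
Proof. by move=> f; exact: affinity_eq. Qed.
Lemma aff_mulV : left_inverse aff_one aff_inv aff_mul.
Proof.
move=> g; apply: affinity_eq => q /=; rewrite /aff_inv_fun.
rewrite -[in g q](diffK (orig E) q) aff_funP shiftK.
by rewrite (lker0_lfunK (lin_inj g)) diffK.
Qed.
Lemma aff_mulrV : right_inverse aff_one aff_inv aff_mul.
Proof.
move=> g; apply: affinity_eq => q /=.
by rewrite /aff_inv_fun aff_funP (lker0_lfunVK (lin_inj g)) diffK.
Qed.

HB.instance Definition _ := gen_eqMixin affinity.
HB.instance Definition _ := gen_choiceMixin affinity.
HB.instance Definition _ := isGroup.Build affinity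
  aff_mulA aff_mul1 aff_mulr1 aff_mulV aff_mulrV.

Definition aff_coord (g : affinity) :
    ('M[R]_(\dim {:V}) * 'rV[R]_(\dim {:V}))%type :=
  (passmx.mxof (vbasis {:V}) (vbasis {:V}) (lin g),
   vcoord (g (orig E) -! orig E)).

HB.instance Definition _ :=
  Topological.copy affinity (initial_topology aff_coord).

Definition GLplus (A : 'End(V)) : Prop :=
  0 < \det (passmx.mxof (vbasis {:V}) (vbasis {:V}) A).

Definition automorphisms (C : 'End(V) -> Prop) (H : set E) : set affinity :=
  [set g | C (lin g) /\ g @` H = H].

Definition line (q : E) (v : V) : set E := [set q +! t *: v | t in setT].

End AffineGroup.

(* R^n ><| Z/2, where Z/2 is [bool] with [addb] and its generator negates the
   coordinate of index [k], indices starting at 0. The group law depends on [k],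
   the underlying space does not. *)
Definition semidirect (R : realType) (n k : nat) : Type :=
  ('rV[R]_n * bool)%type.

Section Semidirect.
Variables (R : realType) (n k : nat).

Definition Z2act (e : bool) (v : 'rV[R]_n) : 'rV[R]_n :=
  \row_j (if e && (j == k :> nat) then - v 0 j else v 0 j).

Local Notation sd := (semidirect R n k).

Definition sd_one : sd := (0, false).
Definition sd_mul (x y : sd) : sd :=
  (x.1 + Z2act x.2 y.1, x.2 (+) y.2).
Definition sd_inv (x : sd) : sd := (- Z2act x.2 x.1, x.2).

Lemma sd_mulA : associative sd_mul.
Proof.
move=> [u a] [v b] [w c]; congr pair; last exact: addbA.
apply/rowP => j; rewrite !mxE /=.
by case: a b => [] []; case: (_ == _) => /=; rewrite ?opprD ?opprK addrA.
Qed.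
Lemma sd_mul1 : left_id sd_one sd_mul.
Proof. by move=> [u a]; congr pair; apply/rowP => j; rewrite !mxE add0r. Qed.
Lemma sd_mulr1 : right_id sd_one sd_mul.
Proof.
move=> [u a]; congr pair; last exact: addbF.
by apply/rowP => j; rewrite !mxE oppr0 if_same addr0.
Qed.
Lemma sd_mulV : left_inverse sd_one sd_inv sd_mul.
Proof.
move=> [u a]; congr pair; last exact: addbb.
by apply/rowP => j; rewrite !mxE /= addNr.
Qed.
Lemma sd_mulrV : right_inverse sd_one sd_inv sd_mul.
Proof.
move=> [u a]; congr pair; last exact: addbb.
by apply/rowP => j; rewrite !mxE /=; case: (_ && _); rewrite ?opprK addrN.
Qed.

HB.instance Definition _ := Topological.copy sd ('rV[R]_n * bool)%type.
HB.instance Definition _ := isGroup.Build sd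
  sd_mulA sd_mul1 sd_mulr1 sd_mulV sd_mulrV.

End Semidirect.

(* The subset [G] of the affine group is isomorphic, as a topological group, to
   R^n ><| Z/2. Bare group isomorphism would not be enough to distinguish the
   different [n], since the vector spaces R^n, n > 0, are isomorphic over Q. *)
Definition isog_semidirect (R : realType) (V : vectType R) (E : affineSpace V)
    (G : set (affinity E)) (n k : nat) : Prop :=
  exists (phi : semidirect R n k -> affinity E)
         (psi : affinity E -> semidirect R n k),
    [/\ {morph phi : x y / (x * y)%g >-> (x * y)%g},
        range phi = G,
        cancel phi psi,
        continuous phi
      & {within G, continuous psi}].

Section Lorentz.
Variables (R : realType) (V : vectType R) (B : {symmetric V}).

Definition signature21 : Prop :=
  exists2 e : 3.-tuple V, basis_of fullv e &
    forall i j : 'I_3, B e`_i e`_j =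
      if i != j then 0 else if i == 2%N :> nat then -1 else 1.

Definition timelike : set V := [set v | B v v < 0].

Definition time_orientation (Future : set V) : Prop :=
  exists2 t, timelike t &
    vcoord @` Future = connected_component (vcoord @` timelike) (vcoord t).

Definition future_pointing (Future : set V) (v : V) : Prop :=
  [/\ v != 0, B v v <= 0 & closure (vcoord @` Future) (vcoord v)].

(* The orientation of V is the one of the basis [b]. *)
Definition positively_oriented (b e : 3.-tuple V) : Prop :=
  0 < \det (\matrix_(i < 3, j < 3) coord b j e`_i).

(* [s] is unit-spacelike and [sm], [sp] stand for s^-, s^+, which s determines
   only up to (s^-, s^+) |-> (a s^-, a^-1 s^+), a > 0. *)
Definition null_frame (b : 3.-tuple V) (Future : set V) (s sm sp : V) : Prop :=
  [/\ B s s = 1,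
      [/\ B sm s = 0, B sm sm = 0 & future_pointing Future sm],
      [/\ B sp s = 0, B sp sp = 0 & future_pointing Future sp],
      B sm sp = -1
    & positively_oriented b [tuple s; sm; sp]].

Definition linear_isometry (A : 'End(V)) : Prop :=
  forall u v, B (A u) (A v) = B u v.

Definition SO21 (A : 'End(V)) : Prop := linear_isometry A /\ GLplus A.

Definition SO21xRplus (A : 'End(V)) : Prop :=
  exists (a : R) (A0 : 'End(V)), [/\ 0 < a, SO21 A0 & A = a *: A0].

Variable E : affineSpace V.

Definition crooked_halfspace (p : E) (s sm sp : V) : set E :=
  [set q | B (q -! p) sp < 0 /\ B (q -! p) s > 0] `|`
  [set q | [/\ B (q -! p) sp < 0, B (q -! p) sm > 0 & B (q -! p) s = 0]] `|`
  [set q | B (q -! p) sm > 0 /\ B (q -! p) s < 0].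

Definition involution (g : affinity E) : Prop :=
  g <> 1%g /\ (g * g)%g = 1%g.

(* Tachyons are the lines [line q v] with [0 < B v v]. *)
Definition is_reflection (g : affinity E) (q : E) (v : V) : Prop :=
  [/\ involution g, forall x, line q v x -> g x = x
    & forall w, B w v = 0 -> lin g w = - w].

(* The lines are required to meet, at a right angle. *)
Definition orthogonal_lines (q : E) (v : V) (p : E) (s : V) : Prop :=
  line q v `&` line p s !=set0 /\ B v s = 0.

Definition reverses_time (Future : set V) (A : 'End(V)) : Prop :=
  A @` Future = [set - v | v in Future].

End Lorentz.

(* Main.v *)
Require Import Defs.
From HB Require Import structures.
From mathcomp Require Import all_boot all_order all_algebra ring lra.
From mathcomp Require Import all_classical all_reals all_analysis.
Import Order.TTheory GRing.Theory Num.Theory.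
Import numFieldNormedType.Exports.
Local Open Scope classical_set_scope.
Local Open Scope ring_scope.

(** Write a point as p + x s + y s^- - w s^+. In these coordinates the halfspace
    is {x > 0, y > 0} U {x = 0, y > 0, w > 0} U {x < 0, w > 0}, and the lines it
    contains have the directions D = +-{x > 0, y >= 0, w <= 0} U {x = 0, y w = 0}.
    The linear part of an affine automorphism preserves D; this forces it to be
    diagonal, or diagonal composed with the half turn (x, y, w) |-> (-x, w, y),
    and the halfspace then forces positive diagonal entries and a fixed vertex.
    In terms of the logarithms a, b, c of the entries, the half turn exchanges b
    and c: this gives R^3 ><| Z/2, where similarities are cut out by b + c = 2 a
    and isometries by a = 0 = b + c. The involutions are the half turns composed with
    (x, y, w) |-> (x, e^b y, e^-b w); they exchange the components of the timelike
    cone, which are separated by the sign of y. *)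

Set Implicit Arguments.
Unset Strict Implicit.

(** * Automorphisms in coordinates *)

Section CrookedCoordinates.
Variable R : realType.
Implicit Types a b c t u v w x y z : R.

Definition crooked x y w : Prop :=
  [\/ 0 < x /\ 0 < y, [/\ x = 0, 0 < y & 0 < w] | x < 0 /\ 0 < w].

(* Here [z] is [- w]: the coordinate on s^+ itself, so that the directions form,
   up to sign, the positive octant. *)
Definition inner_direction x y z : Prop :=
  [\/ [/\ 0 < x, 0 <= y & 0 <= z], [/\ x < 0, y <= 0 & z <= 0]
    | x = 0 /\ (y = 0 \/ z = 0)].

(** Serves to go so far along a line or an axis that the linear terms outweigh both constants. *)
Lemma affine_gt0_large x a y b : 0 < a -> 0 < b ->
  exists t, [/\ 0 < t, 0 < x + t * a & 0 < y + t * b].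
Proof.
move=> a0 b0; exists (`|x| / a + `|y| / b + 1).
have xa : 0 <= `|x| / a by rewrite divr_ge0 // ltW.
have yb : 0 <= `|y| / b by rewrite divr_ge0 // ltW.
have ea : `|x| / a * a = `|x| by rewrite divfK // gt_eqF.
have eb : `|y| / b * b = `|y| by rewrite divfK // gt_eqF.
have := ler_norm (- x); have := ler_norm (- y); rewrite !normrN => ny nx.
split; first by lra.
  by rewrite !mulrDl ea mul1r; have := mulr_ge0 yb (ltW a0); lra.
by rewrite !mulrDl eb mul1r; have := mulr_ge0 xa (ltW b0); lra.
Qed.

(** If [a] is nonzero, the first coordinate tends to both infinities along the line. The second must
    stay positive at the end where the first is positive, and the third at the other end, so neither
    [b] nor [c] can have the sign opposite to [a]. *)
Lemma crooked_line_direction x y w a b c :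
  (forall t, crooked (x + t * a) (y + t * b) (w - t * c)) ->
  inner_direction a b c.
Proof.
move=> xyw.
have notpos t : 0 < x + t * a -> 0 < y + t * b.
  by move=> ?; case: (xyw t) => [[]|[]|[]] //; lra.
have notneg t : x + t * a < 0 -> 0 < w - t * c.
  by move=> ?; case: (xyw t) => [[]|[]|[]] //; lra.
case: (ltrgtP a 0) => a0.
- apply: Or32; split => //; rewrite leNgt; apply/negP => bc.
    have a'0 : 0 < - a by lra.
    have [t [_ xt yt]] := affine_gt0_large x (- y) a'0 bc.
    by have := notpos (- t); lra.
  have a'0 : 0 < - a by lra.
  have [t [_ xt yt]] := affine_gt0_large (- x) (- w) a'0 bc.
  by have := notneg t; lra.
- apply: Or31; split => //; rewrite leNgt; apply/negP => bc.
    have b'0 : 0 < - b by lra.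
    have [t [_ xt yt]] := affine_gt0_large x (- y) a0 b'0.
    by have := notpos t; lra.
  have c'0 : 0 < - c by lra.
  have [t [_ xt yt]] := affine_gt0_large (- x) (- w) a0 c'0.
  by have := notneg (- t); lra.
- apply: Or33; split => //.
  have [b0|b0] := eqVneq b 0; first by left.
  have [c0|c0] := eqVneq c 0; first by right.
  (* At [- y / b] the second coordinate vanishes, which forces [x < 0]; at [w / c] the third
     vanishes, which forces [0 < x]. *)
  have := xyw (- y / b); have := xyw (w / c).
  have -> : w / c * c = w by rewrite divfK.
  have -> : - y / b * b = - y by rewrite divfK.
  by rewrite a0 !mulr0 !addr0 !subrr; case=> [[]|[]|[]] *;
    match goal with H : crooked _ _ _ |- _ => case: H => [[]|[]|[]] * end; lra.
Qed.

(** A direction transverse to the plane x = 0 gets the line through (0, 1, 1), which crosses that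
    plane in the middle branch of [crooked]. A direction inside the plane gets a line in x = 1 or x
    = -1, along which the one coordinate that matters stays equal to 1. *)
Lemma inner_direction_line a b c : inner_direction a b c ->
  exists x y w, forall t, crooked (x + t * a) (y + t * b) (w - t * c).
Proof.
case=> [[a0 b0 c0]|[a0 b0 c0]|[a0 [b0|c0]]].
- exists 0, 1, 1 => t; case: (ltrgtP t 0) => t0.
  + by apply: Or33; split; nra.
  + by apply: Or31; split; nra.
  + by apply: Or32; rewrite t0; split; lra.
- exists 0, 1, 1 => t; case: (ltrgtP t 0) => t0.
  + by apply: Or31; split; nra.
  + by apply: Or33; split; nra.
  + by apply: Or32; rewrite t0; split; lra.
- by exists 1, 1, 0 => t; rewrite a0 b0; apply: Or31; split; lra.
- by exists (-1), 0, 1 => t; rewrite a0 c0; apply: Or33; split; lra.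
Qed.

(** The half turn is a symmetry; composing with it later reduces the exchange of the two null axes
    to the diagonal case. *)
Lemma crooked_swap x y w : crooked (- x) w y <-> crooked x y w.
Proof.
by split; case=> [[]|[]|[]] *; [apply: Or33|apply: Or32|apply: Or31
  |apply: Or33|apply: Or32|apply: Or31]; split; lra.
Qed.

Lemma inner_direction_swap x y z : inner_direction x y z <-> inner_direction x z y.
Proof.
by split; case=> [[]|[]|[? []]] *;
  do ?[by apply: Or31]; do ?[by apply: Or32]; apply: Or33; split; auto.
Qed.

Lemma inner_directionN x y z :
  inner_direction (- x) (- y) (- z) <-> inner_direction x y z.
Proof.
by split; case=> [[]|[]|[? []]] *;
 [apply: Or32|apply: Or31|apply: Or33; split; [lra|left; lra]
 |apply: Or33; split; [lra|right; lra]
 |apply: Or32|apply: Or31|apply: Or33; split; [lra|left; lra]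
 |apply: Or33; split; [lra|right; lra]]; split; lra.
Qed.

Definition same_sign a b c :=
  [/\ 0 < a, 0 < b & 0 < c] \/ [/\ a < 0, b < 0 & c < 0].

(** * Linear maps preserving the inner directions *)

Section DirectionPreserving.
Variables x1 y1 z1 x2 y2 z2 x3 y3 z3 : R.
Hypothesis preserves : forall x y z, inner_direction x y z <->
  inner_direction (x * x1 + y * x2 + z * x3) (x * y1 + y * y2 + z * y3)
                  (x * z1 + y * z2 + z * z3).

(** The preimage (1, -t, 0) has coordinates of opposite signs, so it is not an inner direction. *)
Lemma direction_image1N0 t : 0 < t ->
  ~ inner_direction (x1 - t * x2) (y1 - t * y2) (z1 - t * z2).
Proof.
move=> t0 d; have /(proj2 (preserves _ _ _)) : inner_direction
    (1 * x1 + - t * x2 + 0 * x3) (1 * y1 + - t * y2 + 0 * y3)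
    (1 * z1 + - t * z2 + 0 * z3) by rewrite !mul1r !mulNr !mul0r !addr0.
by case=> [[]|[]|[]] *; lra.
Qed.

Lemma direction_image10N t : 0 < t ->
  ~ inner_direction (x1 - t * x3) (y1 - t * y3) (z1 - t * z3).
Proof.
move=> t0 d; have /(proj2 (preserves _ _ _)) : inner_direction
    (1 * x1 + 0 * x2 + - t * x3) (1 * y1 + 0 * y2 + - t * y3)
    (1 * z1 + 0 * z2 + - t * z3) by rewrite !mul1r !mulNr !mul0r !addr0.
by case=> [[]|[]|[]] *; lra.
Qed.

Lemma direction_image100 : inner_direction x1 y1 z1.
Proof.
have /preserves : inner_direction 1 0 0 by apply: Or31; split; lra.
by rewrite !mul1r !mul0r !addr0.
Qed.

Lemma direction_image010 : inner_direction x2 y2 z2.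
Proof.
have /preserves : inner_direction 0 1 0 by apply: Or33; auto.
by rewrite !mul1r !mul0r !addr0 !add0r.
Qed.

Lemma direction_image001 : inner_direction x3 y3 z3.
Proof.
have /preserves : inner_direction 0 0 1 by apply: Or33; auto.
by rewrite !mul1r !mul0r !addr0 !add0r.
Qed.

Lemma direction_image011 t : t != 0 ->
  ~ inner_direction (x2 + t * x3) (y2 + t * y3) (z2 + t * z3).
Proof.
move=> /eqP t0 d; have /(proj2 (preserves _ _ _)) : inner_direction
    (0 * x1 + 1 * x2 + t * x3) (0 * y1 + 1 * y2 + t * y3)
    (0 * z1 + 1 * z2 + t * z3) by rewrite !mul1r !mul0r !add0r.
by case=> [[]|[]|[_ []]] *; lra.
Qed.

(* Among the combinations of the last two basis vectors only the multiples of
   these vectors are inner directions, whereas an inner direction with [x <> 0]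
   could be added to, or subtracted from, any other one. *)
Lemma axes_into_plane : x2 = 0 /\ x3 = 0.
Proof.
have n1 := direction_image011 (oner_neq0 R); have n2 := @direction_image011 (-1).
have {}n2 : ~ inner_direction (x2 - x3) (y2 - y3) (z2 - z3).
  by move: n2; rewrite oppr_eq0 oner_neq0 !mulN1r; exact.
move: n1; rewrite !mul1r => n1.
have case0 u : u <= 0 \/ 0 <= u :> R by case: (lerP u 0) => ?; [left|right; lra].
have close (P : Prop) u v w u' v' w' :
    ~ inner_direction (u + u') (v + v') (w + w') ->
    ~ inner_direction (u - u') (v - v') (w - w') ->
    [/\ 0 < u, 0 <= v & 0 <= w] -> inner_direction u' v' w' -> P.
  move=> m1 m2 [u0 v0 w0] [[? ? ?]|[? ? ?]|[? [?|?]]]; exfalso.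
  - by apply: m1; apply: Or31; split; lra.
  - by apply: m2; apply: Or31; split; lra.
  - by case: (case0 w') => ?; [apply: m2|apply: m1]; apply: Or31; split; lra.
  - by case: (case0 v') => ?; [apply: m2|apply: m1]; apply: Or31; split; lra.
case: direction_image010 => [d2|[? ? ?]|[x20 _]].
- exact: (close _ _ _ _ _ _ _ n1 n2 d2 direction_image001).
- apply: (close _ (- x2) (- y2) (- z2) (- x3) (- y3) (- z3)).
  + by rewrite -3!opprD => /inner_directionN.
  + by rewrite -3!opprD => /inner_directionN.
  + by split; lra.
  + exact/inner_directionN/direction_image001.
- split=> //; case: direction_image001 => [d3|[? ? ?]|[x30 _]] //.
  + apply: (close _ x3 y3 z3 x2 y2 z2) => //; last exact: direction_image010.
      by rewrite !(addrC _ x2) !(addrC _ y2) !(addrC _ z2).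
    by rewrite -(opprB x2) -(opprB y2) -(opprB z2) => /inner_directionN.
  + apply: (close _ (- x3) (- y3) (- z3) (- x2) (- y2) (- z2)).
    * rewrite -3!opprD => /inner_directionN.
      by rewrite !(addrC _ x2) !(addrC _ y2) !(addrC _ z2).
    * by rewrite !opprK !(addrC (- _)).
    * by split; lra.
    * exact/inner_directionN/direction_image010.
Qed.

(** When [x1 > 0], subtracting any positive multiple of the second image (0, [y2], 0) from the first
    must leave the inner directions. This fails if [y2 <= 0], and also if [y1 > 0], for a small
    multiple. The third image is treated alike, and [x1 < 0] follows by negation. *)
Lemma direction_diag : z2 = 0 -> y3 = 0 ->
  [/\ y1 = 0, z1 = 0 & same_sign x1 y2 z3].
Proof.
move=> z20 y30; have [x20 x30] := axes_into_plane.
have d2 t := @direction_image1N0 t; have d3 t := @direction_image10N t.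
move: d2 d3; rewrite x20 x30 z20 y30 => d2 d3.
have h u v : v != 0 -> u / (2 * v) * v = u / 2 :> R.
  by move=> v0; field; rewrite v0.
have pos (v u1 v1 w1 : R) : 0 < u1 -> 0 <= v1 -> 0 <= w1 ->
    (forall t, 0 < t -> ~ inner_direction (u1 - t * 0) (v1 - t * v) (w1 - t * 0)) ->
    v1 = 0 /\ 0 < v.
  move=> u10 v10 w10 d.
  have v0 : 0 < v.
    rewrite ltNge; apply/negP => v0; apply: (d 1 ltr01).
    by apply: Or31; split; lra.
  split=> //; apply/eqP; rewrite eq_le v10 andbT leNgt; apply/negP => v1p.
  (* Half of the multiple that would cancel [v1]: it leaves [v1 / 2 > 0]. *)
  apply: (d (v1 / (2 * v))); first by rewrite divr_gt0 // mulr_gt0.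
  by rewrite h ?gt_eqF //; apply: Or31; split; lra.
case: direction_image100 => [[x10 y10 z10]|[x10 y10 z10]|[x10 yz]].
- have [-> y2p] := pos y2 x1 y1 z1 x10 y10 z10 d2.
  have [|-> z3p] := pos z3 x1 z1 y1 x10 z10 y10.
    by move=> t t0 /inner_direction_swap; exact: d3.
  by split=> //; left.
- have m u v : - u - v * 0 = - (u - v * 0) by rewrite !mulr0 !subr0.
  have m' u v w : - u - v * (- w) = - (u - v * w) by rewrite mulrN opprB addrC opprK.
  have [] := pos (- y2) (- x1) (- y1) (- z1); try lra.
    by move=> t t0; rewrite m' !m => /inner_directionN; exact: d2.
  have [] := pos (- z3) (- x1) (- z1) (- y1); try lra.
    by move=> t t0; rewrite m' !m => /inner_directionN /inner_direction_swap; exact: d3.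
  by move=> ? ? ? ?; split; [lra|lra|right; split; lra].
(* With [x1 = 0], one of the two subtractions stays on a null axis, hence among the inner
   directions. *)
- exfalso; case: yz => [y0|z0].
    by apply: (d3 1 ltr01); apply: Or33; split; [lra|left; lra].
  by apply: (d2 1 ltr01); apply: Or33; split; [lra|right; lra].
Qed.

End DirectionPreserving.

(** Negative entries would send a point with x and w large to one with both negative. Otherwise
    membership is the sign of y on a slice where x is large, and the sign of w where -x is large;
    comparing such half-lines with their images kills the translation. *)
Lemma automorphism_diag t1 t2 t3 a b c :
  (forall x y w, crooked (t1 + a * x) (t2 + b * y) (t3 + c * w) <-> crooked x y w) ->
  same_sign a b c -> [/\ 0 < a, 0 < b, 0 < c & [/\ t1 = 0, t2 = 0 & t3 = 0]].
Proof.
move=> F [[a0 b0 c0]|[a0 b0 c0]]; last first.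
  have c'0 : 0 < - c by lra.
  have a'0 : 0 < - a by lra.
  have [M [M0 _ hM]] := affine_gt0_large 0 (- t3) ltr01 c'0.
  have [T [T0 _ hT]] := affine_gt0_large 0 (- t1) ltr01 a'0.
  have : crooked T 1 M by apply: Or31; split; lra.
  by move/F; case=> [[]|[]|[]] *; lra.
have eV u v : 0 < v -> v * (u / v) = u by move=> v0; rewrite mulrCA divff ?mulr1 ?gt_eqF.
have eq0 t v (P : R -> Prop) : 0 < v -> (forall y, P y <-> 0 < y) ->
    (forall y, P y <-> 0 < t + v * y) -> t = 0.
  move=> v0 P1 P2; apply/eqP; rewrite eq_le !leNgt; apply/andP; split; apply/negP => t0.
    have : P 0 by apply/P2; lra.
    by move/P1; lra.
  have : P (- t / v) by apply/P1; rewrite divr_gt0 //; lra.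
  by move/P2; rewrite eV //; lra.
have crooked_pos x y w : 0 < x -> crooked x y w <-> 0 < y.
  by move=> x0; split; [case=> [[]|[]|[]] *; lra|move=> ?; apply: Or31; split; lra].
have crooked_neg x y w : x < 0 -> crooked x y w <-> 0 < w.
  by move=> x0; split; [case=> [[]|[]|[]] *; lra|move=> ?; apply: Or33; split; lra].
have t20 : t2 = 0.
  have [T [T0 _ hT]] := affine_gt0_large 0 t1 ltr01 a0.
  apply: (eq0 t2 b (fun y => crooked T y 0)) => // y; first exact: crooked_pos.
  rewrite -(crooked_pos (t1 + a * T) _ (t3 + c * 0)); last by lra.
  by split=> /F.
have t30 : t3 = 0.
  have [T [T0 _ hT]] := affine_gt0_large 0 (- t1) ltr01 a0.
  apply: (eq0 t3 c (fun w => crooked (- T) 0 w)) => // w.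
    by apply: crooked_neg; lra.
  rewrite -(crooked_neg (t1 + a * - T) (t2 + b * 0) _); last by lra.
  by split=> /F.
split=> //; split=> //.
(* With y = 1 and w = -1 only the first branch of [crooked] can hold; the image keeps these signs
   because [t2] and [t3] vanish. *)
apply: (eq0 t1 a (fun x => crooked x 1 (- 1))) => // x.
  by split; [case=> [[]|[]|[]] *; lra|move=> ?; apply: Or31; split; lra].
have H : crooked (t1 + a * x) (t2 + b * 1) (t3 + c * -1) <-> 0 < t1 + a * x.
  rewrite t20 t30; split; [case=> [[]|[]|[]] *; lra|move=> ?; apply: Or31; split; lra].
by rewrite -H; split=> /F.
Qed.

(* The columns [(x_i, y_i, z_i)] are the images of s, s^-, s^+, in coordinates on
   s, s^-, s^+; this accounts for the signs of [w] and [z_i]. *)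
Lemma crooked_automorphism t1 t2 t3 x1 y1 z1 x2 y2 z2 x3 y3 z3 :
  let F x y w := (t1 + (x * x1 + y * x2 - w * x3),
                  t2 + (x * y1 + y * y2 - w * y3),
                  t3 - (x * z1 + y * z2 - w * z3)) in
  (forall x y w, let: (x', y', w') := F x y w in
     crooked x' y' w' <-> crooked x y w) ->
  (forall x' y' w', exists x y w, F x y w = (x', y', w')) ->
  exists a b c e, [/\ 0 < a, 0 < b, 0 < c & forall x y w, F x y w =
    if e then (- (a * x), b * w, c * y) else (a * x, b * y, c * w)].
Proof.
move=> F Faut Fsurj.
have Fiff x y w : crooked (t1 + (x * x1 + y * x2 - w * x3))
    (t2 + (x * y1 + y * y2 - w * y3)) (t3 - (x * z1 + y * z2 - w * z3)) <->
  crooked x y w := Faut x y w.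
(* Lines inside the halfspace go to such lines; conversely a line inside the halfspace in the image
   direction pulls back, its base point being an image by surjectivity. *)
have pres x y z : inner_direction x y z <->
  inner_direction (x * x1 + y * x2 + z * x3) (x * y1 + y * y2 + z * y3)
                  (x * z1 + y * z2 + z * z3).
  split=> [/inner_direction_line[u [v [w uvw]]]|].
    apply: (@crooked_line_direction (t1 + (u * x1 + v * x2 - w * x3))
      (t2 + (u * y1 + v * y2 - w * y3)) (t3 - (u * z1 + v * z2 - w * z3))) => t.
    by have /Fiff := uvw t; congr crooked; ring.
  move=> /inner_direction_line[u' [v' [w' uvw]]].
  have [u [v [w [E1 E2 E3]]]] := Fsurj u' v' w'.
  apply: (@crooked_line_direction u v w) => t; apply/Faut.
  by move: (uvw t); rewrite -E1 -E2 -E3; congr crooked; ring.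
have [x20 x30] := axes_into_plane pres.
have eq_crooked u v w u' v' w' : u = u' -> v = v' -> w = w' ->
  crooked u v w <-> crooked u' v' w' by move=> -> -> ->.
have no_sum := direction_image011 pres (oner_neq0 R).
have case2 : y2 = 0 \/ z2 = 0 by case: (direction_image010 pres) => [[]|[]|[]]; try lra.
have case3 : y3 = 0 \/ z3 = 0 by case: (direction_image001 pres) => [[]|[]|[]]; try lra.
(* Each null axis goes to a null axis. They cannot go to the same one, since the sum of their
   generators would then be sent to an inner direction. *)
case: case2 => [y20|z20]; case: case3 => [y30|z30].
- by case: no_sum; apply: Or33; split; [lra|left; lra].
- have pres' x y z : inner_direction x y z <->
    inner_direction (x * x1 + y * x2 + z * x3) (x * z1 + y * z2 + z * z3)
                  (x * y1 + y * y2 + z * y3).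
    by rewrite pres inner_direction_swap.
  have [z10 y10 sgn] := direction_diag pres' y20 z30.
  (* The map followed by the half turn is diagonal, with these entries and this translation. *)
  have [| |a0 b0 c0 [t10 t30 t20]] :=
    @automorphism_diag (- t1) t3 t2 (- x1) (- z2) (- y3).
  + move=> x y w; rewrite -(Fiff x y w) -(crooked_swap (t1 + _)).
    by apply: eq_crooked; rewrite ?x20 ?x30 ?y20 ?z30 ?z10 ?y10; ring.
  + by case: sgn => [[]|[]] *; [right|left]; split; lra.
  exists (- x1), (- y3), (- z2), true; split=> // x y w.
  by rewrite /F x20 x30 y20 z30 z10 y10 t20 t30 (_ : t1 = 0); [congr (_, _, _); ring|lra].
- have [y10 z10 sgn] := direction_diag pres z20 y30.
  have [|a0 b0 c0 [t10 t20 t30]] := @automorphism_diag t1 t2 t3 x1 y2 z3 _ sgn.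
  + move=> x y w; rewrite -(Fiff x y w).
    by apply: eq_crooked; rewrite ?x20 ?x30 ?z20 ?y30 ?z10 ?y10; ring.
  exists x1, y2, z3, false; split=> // x y w.
  by rewrite /F x20 x30 z20 y30 z10 y10 t10 t20 t30; congr (_, _, _); ring.
- by case: no_sum; apply: Or33; split; [lra|right; lra].
Qed.

End CrookedCoordinates.

(** * Differences of points *)

Section AffineSpaceTheory.
Variables (V : zmodType) (E : affineSpace V).
Implicit Types (q r : E) (v : V).

Lemma diff_shift q r v : (q +! v) -! r = (q -! r) + v.
Proof. by rewrite -{1}(diffK r q) -shiftD shiftK. Qed.

Lemma diff_inj r : injective (fun q : E => q -! r).
Proof. by move=> q q' /= e; rewrite -(diffK r q) e diffK. Qed.

End AffineSpaceTheory.

(** * Continuity in coordinates *)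

Section MatrixContinuity.
Variable R : realType.

Lemma cvg_mx (T : Type) (F : set_system T) {FF : Filter F} m n
    (f : T -> 'M[R]_(m, n)) (M : 'M[R]_(m, n)) :
  (forall i j, f x i j @[x --> F] --> M i j) -> f x @[x --> F] --> M.
Proof.
move=> fM A [P MP sPA]; apply: filterS (sPA : _ `<=` A) _ => //=.
by apply: filter_forall => i; apply: filter_forall => j; exact: fM (MP i j).
Qed.

Lemma continuous_coord n (j : 'I_n) : continuous (fun v : 'rV[R]_n => v 0 j).
Proof. exact: coord_continuous. Qed.

Lemma continuous_mx (T : topologicalType) m n (f : T -> 'M[R]_(m, n)) :
  (forall i j, continuous (fun x => f x i j)) -> continuous f.
Proof. by move=> fc x; apply: cvg_mx => i j; exact: fc. Qed.

Lemma continuous_sum (T : topologicalType) (I : finType) (f : I -> T -> R) :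
  (forall i, continuous (f i)) -> continuous (fun x => \sum_i f i x).
Proof.
move=> fc x; apply: cvg_big; last by move=> i _; exact: fc.
exact: add_continuous.
Qed.

Lemma continuous_add (T : topologicalType) (f g : T -> R) :
  continuous f -> continuous g -> continuous (fun x => f x + g x).
Proof. by move=> fc gc x; apply: cvgD; [exact: fc|exact: gc]. Qed.

Lemma continuousMr (T : topologicalType) (f : T -> R) (a : R) :
  continuous f -> continuous (fun x => f x * a).
Proof. by move=> fc x; apply: cvgMr_tmp; exact: fc. Qed.

Lemma continuous_pair (T U W : topologicalType) (f : T -> U) (g : T -> W) :
  continuous f -> continuous g -> continuous (fun x => (f x, g x)).
Proof. by move=> fc gc x; apply: cvg_pair; [exact: fc|exact: gc]. Qed.

(** The model of the inverse isomorphism: parameters are logarithms and the component is a sign,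
    which is locally constant where [x] does not vanish. *)
Lemma continuous_ln_sign (T : topologicalType) n (x y w : T -> R) (t : T)
    (ra rb rc : 'rV[R]_n) :
  continuous x -> continuous y -> continuous w -> x t != 0 -> 0 < y t -> 0 < w t ->
  {for t, continuous (fun z =>
    (ln `|x z| *: ra + ln (y z) *: rb + ln (w z) *: rc, x z < 0))}.
Proof.
move=> xc yc wc x0 y0 w0.
have row_cvg : (ln `|x z| *: ra + ln (y z) *: rb + ln (w z) *: rc) @[z --> t] -->
    ln `|x t| *: ra + ln (y t) *: rb + ln (w t) *: rc.
  apply: cvg_mx => i j; rewrite !mxE; under eq_fun do rewrite !mxE.
  apply: cvgD; first apply: cvgD; apply: cvgMr_tmp; apply: continuous_cvg.
  - by apply: continuous_ln; rewrite normr_gt0.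
  - by apply: cvg_norm; exact: xc.
  - exact: continuous_ln.
  - exact: yc.
  - exact: continuous_ln.
  - exact: wc.
suff sign_cvg : (x z < 0) @[z --> t] --> (x t < 0) by exact: cvg_pair row_cvg sign_cvg.
move=> A /nbhs_singleton /= At; have [x1|x1] := ltP (x t) 0.
  move: At; rewrite x1 => At.
  by apply: filterS (cvgr_lt _ (xc t) _ x1) => z /= ->.
move: At; rewrite ltNge x1 /= => At.
have {}x1 : 0 < x t by rewrite lt_neqAle eq_sym x0.
by apply: filterS (cvgr_gt _ (xc t) _ x1) => z /= z0; rewrite ltNge ltW.
Qed.

Lemma continuous_prod_bool (T U : topologicalType) (f : T * bool -> U) :
  (forall e, continuous (fun t => f (t, e))) -> continuous f.
Proof.
move=> fc [t e] A /(fc e t) At; exists ([set t | A (f (t, e))], [set e]).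
  by split=> //=; exact: discrete_set1.
by move=> [t' e'] [/= + ->].
Qed.

End MatrixContinuity.

Section VectorContinuity.
Variables (R : realType) (V : vectType R) (B : {symmetric V}).
Local Notation vb := (vbasis {:V}).

Lemma vcoordK : cancel vcoord (passmx.vecof vb).
Proof. exact: passmx.rVofK (vbasisP _). Qed.

Lemma vcoord_inj : injective (@vcoord R V).
Proof. exact: can_inj vcoordK. Qed.

Lemma vcoordP a u v : vcoord (a *: u + v) = a *: vcoord u + vcoord v :> 'rV[R]_(\dim {:V}).
Proof. exact: passmx.rVof_linear. Qed.

Lemma vcoordZ a v : vcoord (a *: v) = a *: vcoord v :> 'rV[R]_(\dim {:V}).
Proof.
have v0 : vcoord 0 = 0 :> 'rV[R]_(\dim {:V}).
  by have := vcoordP (-1) (0 : V) 0; rewrite !scaleN1r !addNr.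
by rewrite -[a *: v]addr0 vcoordP v0 addr0.
Qed.

Lemma continuous_form w : continuous (fun c => B (passmx.vecof vb c) w).
Proof.
have -> : (fun c => B (passmx.vecof vb c) w) = (fun c => \sum_i c 0 i * B vb`_i w).
  apply/funext => c; rewrite /passmx.vecof linear_sumlz.
  by apply: eq_bigr => i _; exact: linearZl_LR.
apply: continuous_sum => i; apply: continuousMr; exact: coord_continuous.
Qed.

Variable E : affineSpace V.

(** The map factors through [aff_coord], for which the topology is initial, and depends linearly on
    the matrix entries. *)
Lemma continuous_lin_form u w : continuous (fun g : affinity E => B (lin g u) w).
Proof.
move=> g; have -> : (fun g : affinity E => B (lin g u) w) =
    (fun c => B (passmx.vecof vb c) w) \o (fun M => vcoord u *m M) \o fst \o @aff_coord R V E.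
  by apply/funext => h /=; rewrite -passmx.rVof_app ?vbasisP // vcoordK.
apply: continuous_comp; first exact: initial_continuous.
apply: continuous_comp; first exact: cvg_fst.
apply: continuous_comp; last exact: continuous_form.
move: (aff_coord g).1; apply: continuous_mx => i j.
have -> : (fun M : 'M[R]_(\dim {:V}, \dim {:V}) => (vcoord u *m M) i j) =
    (fun M => \sum_k M k j * vcoord u i k).
  by apply/funext => M; rewrite mxE; apply: eq_bigr => k _; rewrite mulrC.
apply: continuous_sum => k; apply: continuousMr; exact: coord_continuous.
Qed.

End VectorContinuity.

(** * Sign of the determinant, and stabilizers of sets *)

Section LinearGroup.
Variables (R : realType) (V : vectType R) (E : affineSpace V).

(** The determinant of [A \o A] is a square, nonzero because [A] is invertible. This gives
    positivity without a change of basis from [vbasis] to the frame. *)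
Lemma GLplus_sqr (A : 'End(V)) : lker A == 0%VS -> GLplus (A \o A)%VF.
Proof.
move=> A0; have mulE (f h : 'End(V)) :=
  @passmx.mxof_comp _ V V V (vbasis {:V}) _ (vbasis {:V}) (vbasisP {:V}) f h.
rewrite /GLplus mulE det_mulmx -expr2 exprn_even_gt0 //=.
have := mulE A A^-1%VF.
rewrite lker0_compVf // passmx.mxof1 ?(basis_free (vbasisP _)) //.
by move/(congr1 determinant); rewrite det1 det_mulmx => /esym/eqP;
  apply: contraTneq => ->; rewrite mul0r eq_sym oner_eq0.
Qed.

Lemma GLplus_comp (A C : 'End(V)) : GLplus A -> GLplus C -> GLplus (A \o C)%VF.
Proof.
move=> A0 C0; rewrite /GLplus (passmx.mxof_comp _ _ (vbasisP _)) det_mulmx.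
exact: mulr_gt0.
Qed.

Lemma affinity_surj (g : affinity E) q : exists r, g r = q.
Proof.
exists (aff_inv g q).
by have := congr1 (fun h : affinity E => h q) (aff_mulrV g).
Qed.

Lemma affinity_inj (g : affinity E) : injective g.
Proof.
have K x : aff_inv g (g x) = x := congr1 (fun h : affinity E => h x) (aff_mulV g).
by move=> q r /(congr1 (aff_inv g)); rewrite !K.
Qed.

Lemma affinity_stabilize (g : affinity E) (X : set E) :
  g @` X = X <-> forall q, X (g q) <-> X q.
Proof.
split=> [gX q|gX]; last first.
  apply/seteqP; split=> [_ [q Xq <-]|q Xq]; first exact/gX.
  by have [r rq] := affinity_surj g q; exists r => //; apply/gX; rewrite rq.
split=> [|Xq]; last by rewrite -gX; exists q.
by rewrite -{1}gX => -[r Xr /affinity_inj <-].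
Qed.

End LinearGroup.

(** * Bilinearity of the form *)

Section SymmetricForm.
Variables (R : realType) (V : vectType R) (B : {symmetric V}).

Lemma form_sym u v : B u v = B v u.
Proof. by rewrite hermC expr0 mul1r. Qed.

Lemma formDl u v w : B (u + v) w = B u w + B v w. Proof. exact: linearDl. Qed.
Lemma formDr u v w : B w (u + v) = B w u + B w v. Proof. exact: linearDr. Qed.
Lemma formNl u w : B (- u) w = - B u w. Proof. exact: linearNl. Qed.
Lemma formNr u w : B w (- u) = - B w u. Proof. exact: linearNr. Qed.
Lemma formZl a u w : B (a *: u) w = a * B u w. Proof. exact: linearZl_LR. Qed.
Lemma formZr a u w : B w (a *: u) = a * B w u. Proof. exact: linearZr_LR. Qed.

Definition formE := (formDl, formDr, formNl, formNr, formZl, formZr).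

End SymmetricForm.

Lemma expR_neq0 (R : realType) (x : R) : expR x != 0.
Proof. by rewrite gt_eqF // expR_gt0. Qed.

Lemma Z2act_false (R : realType) n k (v : 'rV[R]_n) : Z2act k false v = v.
Proof. by apply/rowP => j; rewrite mxE. Qed.

(** * Crooked halfspaces and null frames *)

Section NullFrame.
Variables (R : realType) (V : vectType R) (B : {symmetric V}) (s sm sp : V).
Hypothesis dimV : \dim {:V} = 3%N.
Hypothesis Bss : B s s = 1.
Hypothesis Bms : B sm s = 0.
Hypothesis Bmm : B sm sm = 0.
Hypothesis Bps : B sp s = 0.
Hypothesis Bpp : B sp sp = 0.
Hypothesis Bmp : B sm sp = -1.

(** Coordinates by duality: as [B sm sp = -1], pairing with [sp] gives minus the coordinate on [sm],
    and pairing with [sm] gives minus the one on [sp]. *)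
Definition cx v := B v s.
Definition cy v := - B v sp.
Definition cw v := B v sm.
Definition frame_vec x y w := x *: s + y *: sm - w *: sp.

Lemma gram_sym : [/\ B s sm = 0, B s sp = 0 & B sp sm = -1].
Proof. by split; rewrite form_sym. Qed.

Lemma cx_vec x y w : cx (frame_vec x y w) = x.
Proof. by rewrite /cx /frame_vec !formE Bss Bms Bps; ring. Qed.
Lemma cy_vec x y w : cy (frame_vec x y w) = y.
Proof. have [? h ?] := gram_sym; by rewrite /cy /frame_vec !formE Bmp Bpp h; ring. Qed.
Lemma cw_vec x y w : cw (frame_vec x y w) = w.
Proof. have [h ? k] := gram_sym; by rewrite /cw /frame_vec !formE Bmm h k; ring. Qed.
Definition coord_frame_vecE := (cx_vec, cy_vec, cw_vec).

Lemma frame_vecP k x y w x' y' w' : k *: frame_vec x y w + frame_vec x' y' w' =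
  frame_vec (k * x + x') (k * y + y') (k * w + w').
Proof.
rewrite /frame_vec !scalerDl !scalerDr !scalerA scalerN scalerA opprD.
by rewrite addrACA; congr (_ + _); rewrite addrACA.
Qed.

Lemma frame_free : free [:: s; sm; sp].
Proof.
apply/(@freeP _ _ 3 [tuple s; sm; sp]) => k; rewrite !big_ord_recl big_ord0 /= addr0.
move=> e; have {}e : frame_vec (k ord0) (k (lift ord0 ord0))
   (- k (lift ord0 (lift ord0 ord0))) = 0.
  by rewrite /frame_vec scaleNr opprK -addrA.
have := cw_vec (k ord0) (k (lift ord0 ord0)) (- k (lift ord0 (lift ord0 ord0))).
have := cy_vec (k ord0) (k (lift ord0 ord0)) (- k (lift ord0 (lift ord0 ord0))).
have := cx_vec (k ord0) (k (lift ord0 ord0)) (- k (lift ord0 (lift ord0 ord0))).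
rewrite e /cx /cy /cw !linear0l oppr0 => ex ey ew [[|[|[|]]] h] //.
- by rewrite ex; congr k; exact/val_inj.
- by rewrite ey; congr k; exact/val_inj.
- transitivity (k (lift ord0 (lift ord0 ord0))); last by lra.
  by congr k; exact/val_inj.
Qed.

Lemma frame_basis : basis_of {:V} [:: s; sm; sp].
Proof. by rewrite basisEfree frame_free subvf dimV. Qed.

Lemma frame_vecE v : v = frame_vec (cx v) (cy v) (cw v).
Proof.
have : v \in <<[tuple s; sm; sp]>>%VS by rewrite (span_basis frame_basis) memvf.
move=> /coord_span; rewrite !big_ord_recl big_ord0 /= addr0.
set x := coord _ _ _; set y := coord _ _ _; set z := coord _ _ _ => e.
have -> : v = frame_vec x y (- z) by rewrite /frame_vec scaleNr opprK -addrA.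
by rewrite !coord_frame_vecE.
Qed.

Lemma frame_vec_inj u v : cx u = cx v -> cy u = cy v -> cw u = cw v -> u = v.
Proof. by move=> ex ey ew; rewrite (frame_vecE u) ex ey ew -frame_vecE. Qed.

Lemma form_frame u v : B u v = cx u * cx v + cy u * cw v + cw u * cy v.
Proof.
by rewrite {1}(frame_vecE v) /frame_vec !formE /cx /cy /cw; ring.
Qed.

Lemma cxD u v : cx (u + v) = cx u + cx v. Proof. by rewrite /cx formDl. Qed.
Lemma cyD u v : cy (u + v) = cy u + cy v. Proof. by rewrite /cy formDl opprD. Qed.
Lemma cwD u v : cw (u + v) = cw u + cw v. Proof. by rewrite /cw formDl. Qed.
Lemma cxZ a u : cx (a *: u) = a * cx u. Proof. by rewrite /cx formZl. Qed.
Lemma cyZ a u : cy (a *: u) = a * cy u. Proof. by rewrite /cy formZl mulrN. Qed.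
Lemma cwZ a u : cw (a *: u) = a * cw u. Proof. by rewrite /cw formZl. Qed.
Definition coordE := (cxD, cyD, cwD, cxZ, cyZ, cwZ).

(** * Diagonal maps and half turns in the frame *)

Definition frame_fun (e : bool) (a b c : R) (v : V) : V :=
  if e then frame_vec (- (a * cx v)) (b * cw v) (c * cy v)
  else frame_vec (a * cx v) (b * cy v) (c * cw v).

Lemma frame_fun_linear e a b c : linear (frame_fun e a b c).
Proof.
move=> k u v; rewrite /frame_fun.
by case: e; rewrite frame_vecP !coordE; congr frame_vec; ring.
Qed.
HB.instance Definition _ e a b c := GRing.isLinear.Build R V V _
  (frame_fun e a b c) (frame_fun_linear e a b c).

Definition frame_lin e a b c : 'End(V) := linfun (frame_fun e a b c).

Lemma frame_linE e a b c v : frame_lin e a b c v = frame_fun e a b c v.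
Proof. by rewrite lfunE. Qed.

(** For [e = true] the half turn acts first and the diagonal map second. Moving the half turn of the
    left factor past the diagonal part of the right one exchanges [b'] and [c']. *)
Lemma frame_lin_comp e a b c e' a' b' c' :
  (frame_lin e a b c \o frame_lin e' a' b' c')%VF =
  frame_lin (e (+) e') (a * a') (b * if e then c' else b') (c * if e then b' else c').
Proof.
apply/lfunP => v; rewrite comp_lfunE !frame_linE /frame_fun.
by case: e; case: e' => /=; apply: frame_vec_inj; rewrite !coord_frame_vecE; ring.
Qed.

Lemma frame_lin1 : frame_lin false 1 1 1 = \1%VF.
Proof.
apply/lfunP => v; rewrite id_lfunE frame_linE /frame_fun.
by rewrite !mul1r -frame_vecE.
Qed.

Lemma frame_lin_inj e a b c : a != 0 -> b != 0 -> c != 0 ->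
  lker (frame_lin e a b c) == 0%VS.
Proof.
move=> a0 b0 c0; apply/lker0P; apply: (can_inj (g := frame_lin e a^-1
  (if e then c^-1 else b^-1) (if e then b^-1 else c^-1))) => v.
rewrite -[RHS]id_lfunE -comp_lfunE frame_lin_comp addbb -frame_lin1.
by congr (frame_lin _ _ _ _ _); case: e; rewrite mulVf.
Qed.

(** In the coordinates x, y - w, y + w the image is (y - w, -x, y + w). The plane turned is
    Lorentzian, so this is not an isometry; only its square is one. *)
Definition quarter_turn (v : V) : V :=
  frame_vec (cy v - cw v) ((cy v + cw v - cx v) / 2) ((cy v + cw v + cx v) / 2).

Lemma quarter_turn_linear : linear quarter_turn.
Proof.
by move=> k u v; rewrite /quarter_turn frame_vecP !coordE; congr frame_vec; field.
Qed.
HB.instance Definition _ := GRing.isLinear.Build R V V _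
  quarter_turn quarter_turn_linear.

Lemma quarter_turn_sqr :
  (linfun quarter_turn \o linfun quarter_turn)%VF = frame_lin true 1 1 1.
Proof.
apply/lfunP => v; rewrite comp_lfunE frame_linE !lfunE /=.
by rewrite /quarter_turn /frame_fun !coord_frame_vecE; congr frame_vec; field.
Qed.

(* Both factors are squares: the half turn [frame_lin true 1 1 1] is the square
   of a quarter turn in the plane orthogonal to its axis. *)
Lemma GLplus_frame_lin e a b c : GLplus (frame_lin e (expR a) (expR b) (expR c)).
Proof.
have pos a' b' c' : GLplus (frame_lin false (expR a') (expR b') (expR c')).
  have -> : frame_lin false (expR a') (expR b') (expR c') =
    (frame_lin false (expR (a' / 2)) (expR (b' / 2)) (expR (c' / 2)) \o
     frame_lin false (expR (a' / 2)) (expR (b' / 2)) (expR (c' / 2)))%VF.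
    by rewrite frame_lin_comp -3!expRD -3!splitr.
  by apply: GLplus_sqr; apply: frame_lin_inj; exact: expR_neq0.
case: e; last exact: pos.
have -> : frame_lin true (expR a) (expR b) (expR c) =
    (frame_lin false (expR a) (expR b) (expR c) \o frame_lin true 1 1 1)%VF.
  by rewrite frame_lin_comp !mulr1.
apply: GLplus_comp; first exact: pos.
rewrite -quarter_turn_sqr; apply: GLplus_sqr; apply/lker0P => u v uv.
have /lker0P inj : lker (frame_lin true 1 1 1) == 0%VS.
  by apply: frame_lin_inj; exact: oner_neq0.
by apply: inj; rewrite -quarter_turn_sqr !comp_lfunE uv.
Qed.

(** * Affine maps fixing the vertex, and the stabilizer of the halfspace *)

Variable E : affineSpace V.
Variable p : E.

Section FrameAffinity.
Variables (e : bool) (a b c : R).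
Let L := frame_lin e (expR a) (expR b) (expR c).
Definition frame_aff_fun (q : E) : E := p +! L (q -! p).
Lemma frame_affP q v : frame_aff_fun (q +! v) = frame_aff_fun q +! L v.
Proof. by rewrite /frame_aff_fun diff_shift linearD shiftD. Qed.
Lemma frame_aff_inj : lker L == 0%VS.
Proof. by apply: frame_lin_inj; exact: expR_neq0. Qed.
Definition frame_aff : affinity E := Affinity frame_affP frame_aff_inj.
End FrameAffinity.

Lemma frame_aff_mul e a b c e' a' b' c' :
  (frame_aff e a b c * frame_aff e' a' b' c')%g =
  frame_aff (e (+) e') (a + a') (b + if e then c' else b')
    (c + if e then b' else c').
Proof.
apply: affinity_eq => q; rewrite /= /frame_aff_fun shiftK -comp_lfunE.
rewrite frame_lin_comp !expRD; congr (_ +! frame_lin _ _ _ _ _); by case: e.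
Qed.

Lemma frame_aff1 : frame_aff false 0 0 0 = 1%g.
Proof.
apply: affinity_eq => q; rewrite /= /frame_aff_fun expR0 frame_lin1 id_lfunE.
by rewrite diffK.
Qed.

Local Notation H := (crooked_halfspace B p s sm sp).

Lemma crooked_halfspaceE q :
  H q <-> crooked (cx (q -! p)) (cy (q -! p)) (cw (q -! p)).
Proof.
rewrite /crooked_halfspace /crooked /cx /cy /cw oppr_gt0; split.
  by case=> [[[? ?]|[? ? ?]]|[? ?]]; [apply: Or31|apply: Or32|apply: Or33].
by case=> [[? ?]|[? ? ?]|[? ?]]; [left; left|left; right|right].
Qed.

Lemma frame_affE e a b c q : frame_aff e a b c q -! p =
  frame_fun e (expR a) (expR b) (expR c) (q -! p).
Proof. by rewrite /= /frame_aff_fun shiftK frame_linE. Qed.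

Lemma crooked_scale (a b c x y w : R) :
  crooked (expR a * x) (expR b * y) (expR c * w) <-> crooked x y w.
Proof.
have e0 t u : (0 < expR t * u) = (0 < u) by rewrite pmulr_rgt0 // expR_gt0.
rewrite /crooked !e0 -(oppr_gt0 (_ * x)) -mulrN e0 oppr_gt0.
have -> : (expR a * x = 0) = (x = 0) => //.
apply/propext; split=> [/eqP|->]; last by rewrite mulr0.
by rewrite mulf_eq0 (negPf (expR_neq0 a)) => /eqP.
Qed.

Lemma frame_aff_stabilizes e a b c : frame_aff e a b c @` H = H.
Proof.
apply/affinity_stabilize => q; rewrite !crooked_halfspaceE frame_affE /frame_fun.
case: e; rewrite !coord_frame_vecE; last exact: crooked_scale.
by rewrite -mulrN crooked_scale crooked_swap.
Qed.

(** In the frame coordinates based at [p], the map has the form treated by [crooked_automorphism],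
    with translation [d]. *)
Lemma stabilizer_frame_aff (g : affinity E) : g @` H = H ->
  exists e a b c, g = frame_aff e a b c.
Proof.
move=> /affinity_stabilize gH.
pose d := g p -! p.
have gE v : g (p +! v) -! p = d + lin g v by rewrite aff_funP diff_shift.
have linv x y w : lin g (frame_vec x y w) = x *: lin g s + y *: lin g sm - w *: lin g sp.
  by rewrite /frame_vec linearB linearD !linearZ.
have cN u : [/\ cx (- u) = - cx u, cy (- u) = - cy u & cw (- u) = - cw u].
  by rewrite /cx /cy /cw !formE.
have cF x y w : [/\ cx (d + lin g (frame_vec x y w)) =
     cx d + (x * cx (lin g s) + y * cx (lin g sm) - w * cx (lin g sp)),
   cy (d + lin g (frame_vec x y w)) =
     cy d + (x * cy (lin g s) + y * cy (lin g sm) - w * cy (lin g sp)) &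
   cw (d + lin g (frame_vec x y w)) =
     cw d - (x * (- cw (lin g s)) + y * (- cw (lin g sm)) - w * (- cw (lin g sp)))].
  have [h1 h2 h3] := cN (w *: lin g sp).
  by rewrite linv !coordE h1 h2 h3 !coordE; split=> //; ring.
(* The third entry of each column is the coordinate on [sp] itself, hence [- cw]. *)
have [||a [b [c [e [a0 b0 c0 Fe]]]]] := @crooked_automorphism R
  (cx d) (cy d) (cw d) (cx (lin g s)) (cy (lin g s)) (- cw (lin g s))
  (cx (lin g sm)) (cy (lin g sm)) (- cw (lin g sm))
  (cx (lin g sp)) (cy (lin g sp)) (- cw (lin g sp)).
- move=> x y w; have [<- <- <-] := cF x y w.
  by rewrite -gE -crooked_halfspaceE gH crooked_halfspaceE shiftK !coord_frame_vecE.
- move=> x y w; have [r gr] := affinity_surj g (p +! frame_vec x y w).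
  exists (cx (r -! p)), (cy (r -! p)), (cw (r -! p)).
  have := cF (cx (r -! p)) (cy (r -! p)) (cw (r -! p)).
  by rewrite -frame_vecE -gE diffK gr shiftK !coord_frame_vecE => -[<- <- <-].
exists e, (ln a), (ln b), (ln c); apply: affinity_eq => q.
apply: (@diff_inj _ _ p); rewrite frame_affE !lnK ?posrE //.
rewrite -[in LHS](diffK p q) gE.
have := Fe (cx (q -! p)) (cy (q -! p)) (cw (q -! p)).
have [<- <- <-] := cF (cx (q -! p)) (cy (q -! p)) (cw (q -! p)).
rewrite -frame_vecE /frame_fun.
by case: e {Fe} => -[h1 h2 h3]; apply: frame_vec_inj; rewrite coord_frame_vecE.
Qed.

(** * Isometries and similarities *)

Lemma linear_isometry_frame_lin e a b c :
  linear_isometry B (frame_lin e (expR a) (expR b) (expR c)) <-> a = 0 /\ b + c = 0.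
Proof.
split=> [Liso|[-> bc] u v]; last first.
  have e1 : expR b * expR c = 1 by rewrite -expRD bc expR0.
  apply/eqP; rewrite -subr_eq0 !frame_linE /frame_fun expR0.
  suff -> : B (frame_fun e 1 (expR b) (expR c) u) (frame_fun e 1 (expR b) (expR c) v)
      - B u v = (expR b * expR c - 1) * (cy u * cw v + cw u * cy v).
    by rewrite e1 subrr mul0r.
  by rewrite /frame_fun; case: e; rewrite !form_frame !coord_frame_vecE; ring.
(* The vector [sm - sp] has coordinates (0, 1, 1) and square 2; its image has square
   [2 * expR (b + c)]. *)
have /expR_inj bc : expR (b + c) = expR 0.
  have := Liso (sm - sp) (sm - sp); rewrite !frame_linE /frame_fun.
  have -> : sm - sp = frame_vec 0 1 1 by rewrite /frame_vec scale0r add0r !scale1r.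
  by case: e {Liso}; rewrite !form_frame !coord_frame_vecE expRD expR0; lra.
have /expR_inj : expR (a + a) = expR 0; last by lra.
have := Liso s s; rewrite !frame_linE /frame_fun.
have -> : s = frame_vec 1 0 0 by rewrite /frame_vec !scale0r addr0 subr0 scale1r.
by case: e {Liso}; rewrite !form_frame !coord_frame_vecE expRD expR0; lra.
Qed.

Lemma frame_linZ k e a b c :
  k *: frame_lin e a b c = frame_lin e (k * a) (k * b) (k * c).
Proof.
apply/lfunP => v; rewrite scale_lfunE !frame_linE /frame_fun -[LHS]addr0.
have -> : 0 = frame_vec 0 0 0 by rewrite /frame_vec !scale0r addr0 subr0.
by case: e; rewrite frame_vecP; congr frame_vec; ring.
Qed.

Lemma SO21_frame_lin e a b c :
  SO21 B (frame_lin e (expR a) (expR b) (expR c)) <-> a = 0 /\ b + c = 0.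
Proof.
rewrite -(linear_isometry_frame_lin e); split=> [[]//|?]; split=> //.
exact: GLplus_frame_lin.
Qed.

(** Dividing by a homothety of ratio [k] lowers all three logarithms by [ln k], and the isometry
    condition forces [ln k = a]. *)
Lemma SO21xRplus_frame_lin e a b c :
  SO21xRplus B (frame_lin e (expR a) (expR b) (expR c)) <-> b + c = a + a.
Proof.
have scaleE k a' b' c' : expR k *: frame_lin e (expR a') (expR b') (expR c') =
    frame_lin e (expR (k + a')) (expR (k + b')) (expR (k + c')).
  by rewrite frame_linZ -3!expRD.
split=> [[k [A [k0 SA E1]]]|bc].
  have E2 : A = frame_lin e (expR (- ln k + a)) (expR (- ln k + b)) (expR (- ln k + c)).
    by rewrite -scaleE E1 scalerA expRN lnK ?posrE // mulVf ?scale1r // gt_eqF.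
  by move: SA; rewrite E2 SO21_frame_lin; lra.
exists (expR a), (frame_lin e (expR (a - a)) (expR (b - a)) (expR (c - a))); split.
- exact: expR_gt0.
- by apply/SO21_frame_lin; lra.
- by rewrite scaleE; congr (frame_lin _ (expR _) (expR _) (expR _)); ring.
Qed.

(** * The components of the timelike cone *)

Lemma continuous_cy : continuous (fun c => cy (passmx.vecof (vbasis {:V}) c)).
Proof.
have -> : (fun c => cy (passmx.vecof (vbasis {:V}) c)) =
    fun c => B (passmx.vecof (vbasis {:V}) c) (- sp).
  by apply/funext => c; rewrite linearNr.
exact: continuous_form.
Qed.

Lemma timelike_neq0 v : timelike B v -> cy v != 0.
Proof.
rewrite /timelike /= form_frame => Bv; apply/eqP => y0; move: Bv; rewrite y0.
by have := sqr_ge0 (cx v); rewrite expr2; lra.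
Qed.

(** A reversed Cauchy-Schwarz inequality. If the product were nonnegative, then [(y1 w2 + y2 w1)^2
    <= (x1 x2)^2 < 4 y1 w1 y2 w2], against [0 <= (y1 w2 - y2 w1)^2]. *)
Lemma timelike_form_lt0 u v : timelike B u -> timelike B v -> 0 < cy u * cy v ->
  B u v < 0.
Proof.
rewrite /timelike /= !form_frame.
set x1 := cx u; set y1 := cy u; set w1 := cw u.
set x2 := cx v; set y2 := cy v; set w2 := cw v => h1 h2 y12.
have {h1}h1 : x1 ^+ 2 < - (2 * (y1 * w1)) by rewrite expr2; lra.
have {h2}h2 : x2 ^+ 2 < - (2 * (y2 * w2)) by rewrite expr2; lra.
have s1 := sqr_ge0 x1; have s2 := sqr_ge0 x2.
have n1 : 0 < - (y1 * w1) by lra.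
have n2 : 0 < - (y2 * w2) by lra.
have sq a b c : 0 < a * b -> 0 < - (b * c) -> 0 < - (a * c) :> R.
  move=> ab bc; have : 0 < (a * b) * - (b * c) by exact: mulr_gt0.
  have -> : a * b * - (b * c) = - (a * c) * b ^+ 2 by ring.
  by rewrite pmulr_lgt0 // exprn_even_gt0 //=; apply: contraTneq ab => ->; rewrite mulr0 ltxx.
have P := sq _ _ _ y12 n2.
have Q : 0 < - (y2 * w1) by apply: sq n1; rewrite mulrC.
rewrite ltNge; apply/negP => h.
have h' : - (y1 * w2) + - (y2 * w1) <= x1 * x2 by lra.
have h3 : (- (y1 * w2) + - (y2 * w1)) ^+ 2 <= (x1 * x2) ^+ 2.
  by rewrite ler_pXn2r // nnegrE; lra.
have h4 : (x1 * x2) ^+ 2 < - (2 * (y1 * w1)) * - (2 * (y2 * w2)).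
  by rewrite exprMn; apply: ltr_pM.
have h5 := sqr_ge0 (y1 * w2 - y2 * w1).
have : (- (y1 * w2) + - (y2 * w1)) ^+ 2 - - (2 * (y1 * w1)) * - (2 * (y2 * w2)) =
  (y1 * w2 - y2 * w1) ^+ 2 by ring.
by lra.
Qed.

(* The component is convex, hence connected; [cy] does not vanish on timelike
   vectors, so it has constant sign on a connected set of them. *)
Lemma timelike_component t v : timelike B t ->
  connected_component (vcoord @` timelike B) (vcoord t) (vcoord v) <->
  timelike B v /\ 0 < cy t * cy v.
Proof.
move=> Tt; split=> [tv|[Tv tv]].
  have [u Tu /vcoord_inj uv] := connected_component_sub tv; subst u.
  split=> //; rewrite ltNge; apply/negP => ytv.
  set C := connected_component _ _ in tv.
  pose f c := cy (passmx.vecof (vbasis {:V}) c).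
  have fc : continuous f := continuous_cy.
  have /connected_intervalP fI : connected (f @` C).
    apply: connected_continuous_connected; first exact: component_connected.
    exact: continuous_subspaceT.
  have ft : (f @` C) (cy t).
    exists (vcoord t); last by rewrite /f vcoordK.
    by apply: connected_component_refl; exists t.
  have fv : (f @` C) (cy v) by exists (vcoord v) => //; rewrite /f vcoordK.
  have [c /connected_component_sub [u1 Tu1 <-]] : (f @` C) 0.
    have := timelike_neq0 Tt; rewrite neq_lt => /orP[yt|yt].
      apply: (fI _ _ ft fv); rewrite ltW //=.
      by move: ytv; rewrite nmulr_rle0.
    apply: (fI _ _ fv ft); rewrite (ltW yt) andbT.
    by move: ytv; rewrite pmulr_rle0.
  by rewrite /f vcoordK => /eqP; exact/negP/timelike_neq0.
pose f (l : R) := vcoord ((1 - l) *: t + l *: v).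
have fc : continuous f.
  move=> l; apply: cvg_mx => i j.
  have fE x : f x i j = (1 - x) * vcoord t i j + x * vcoord v i j.
    by rewrite /f vcoordP vcoordZ !mxE.
  rewrite fE; under eq_fun do rewrite fE.
  apply: cvgD; apply: cvgMr_tmp; last exact: cvg_id.
  by apply: cvgB; [exact: cvg_cst|exact: cvg_id].
have If : connected (f @` `[0, 1]).
  apply: connected_continuous_connected; first exact: segment_connected.
  exact: continuous_subspaceT.
apply: (connected_component_max _ _ If).
- exists 0; first by rewrite /= in_itv /= lexx ler01.
  by rewrite /f subr0 scale1r scale0r addr0.
- move=> y [l +]; rewrite /= in_itv /= => /andP[l0 l1] <-; eexists; last by [].
  rewrite /timelike /= !formE [B v t]form_sym.
  have m : B t v < 0 by exact: timelike_form_lt0.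
  move: Tt Tv; rewrite /timelike /= => Tt Tv.
  (* Strict negativity comes from the term [l * l * B v v], so the endpoint [l = 0] is apart. *)
  have [->|ln] := eqVneq l 0; first by lra.
  have l'0 : 0 < l by rewrite lt_neqAle eq_sym ln.
  have e1 : 0 <= (1 - l) * (1 - l) by rewrite -expr2 sqr_ge0.
  have e2 : 0 <= (1 - l) * l by rewrite mulr_ge0 //; lra.
  have e3 : 0 < l * l by rewrite mulr_gt0.
  have f1 : (1 - l) * (1 - l) * B t t <= 0 by rewrite mulr_ge0_le0 // ltW.
  have f2 : (1 - l) * l * B t v <= 0 by rewrite mulr_ge0_le0 // ltW.
  have f3 : l * l * B v v < 0 by rewrite pmulr_rlt0.
  by lra.
- exists 1; first by rewrite /= in_itv /= lexx ler01.
  by rewrite /f subrr scale1r scale0r add0r.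
Qed.

(** The sign of [cy] on the chosen component is found near [sm]: there [cy] is close to 1, and [sm]
    is a limit of future vectors. *)
Lemma FutureE (Future : set V) v : time_orientation B Future ->
  future_pointing B Future sm -> Future v <-> timelike B v /\ 0 < cy v.
Proof.
move=> [t Tt FE] [_ _ clsm].
have Fv u : Future u <-> timelike B u /\ 0 < cy t * cy u.
  rewrite -timelike_component // -FE; split=> [Fu|[u' Fu' uu']]; first by exists u.
  by move/vcoord_inj: uu' => <-.
have yt : 0 < cy t.
  pose f c := cy (passmx.vecof (vbasis {:V}) c).
  have fc : continuous f := continuous_cy.
  have near_sm : nbhs (vcoord sm) [set c | 0 < f c].
    by apply: (cvgr_gt _ (fc (vcoord sm))); rewrite /f vcoordK /cy Bmp opprK ltr01.
  have [_ [[u /Fv[_ tu] <-]]] := clsm _ near_sm.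
  by rewrite /= /f vcoordK => yu; move: tu; rewrite pmulr_lgt0.
by rewrite Fv pmulr_rgt0.
Qed.

(** * Recovering the parameters, and the involutions *)

Lemma frame_lin_params e a b c :
  let A := frame_lin e (expR a) (expR b) (expR c) in
  [/\ cx (A s) = (if e then - expR a else expR a),
      cy (A (sm - sp)) = expR b & cw (A (sm - sp)) = expR c].
Proof.
(* The half turn fixes (0, 1, 1), so [b] and [c] are read in the same order for both values of
   [e]. *)
have -> : sm - sp = frame_vec 0 1 1 by rewrite /frame_vec scale0r add0r !scale1r.
have {1}-> : s = frame_vec 1 0 0 by rewrite /frame_vec !scale0r addr0 subr0 scale1r.
by rewrite /= !frame_linE /frame_fun; case: e; rewrite !coord_frame_vecE !mulr1.
Qed.

Lemma frame_aff_param_inj e a b c e' a' b' c' :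
  frame_aff e a b c = frame_aff e' a' b' c' -> [/\ e = e', a = a', b = b' & c = c'].
Proof.
move=> /(congr1 (@lin _ _ _)) /= AE.
have := frame_lin_params e a b c; have := frame_lin_params e' a' b' c'.
rewrite /= -AE => -[-> -> ->] [xE /expR_inj -> /expR_inj ->].
have := expR_gt0 a; have := expR_gt0 a'; move: xE.
case: e {AE}; case: e' => xE ? ?; try lra; split=> //; apply: expR_inj; lra.
Qed.

(** The square has logarithms (2a, 2b, 2c) if [e] is false, so that only the identity squares to 1,
    and (2a, b + c, b + c) if [e] is true. *)
Lemma involution_frame_aff e a b c :
  involution (frame_aff e a b c) -> [/\ e = true, a = 0 & b + c = 0].
Proof.
case; rewrite frame_aff_mul -frame_aff1 => ne1 /frame_aff_param_inj[_ a0].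
case: e ne1 => [_ bc _|ne1 b0 c0]; first by split=> //; lra.
by case: ne1; congr (frame_aff _ _ _ _); lra.
Qed.

Lemma half_turn_reflection b : involution (frame_aff true 0 b (- b)) ->
  exists q v, [/\ 0 < B v v, orthogonal_lines B q v p s
    & is_reflection B (frame_aff true 0 b (- b)) q v].
Proof.
(* The vectors fixed by the linear part satisfy x = 0 and y = e^b w. The axis meets the spine at the
   vertex. *)
move=> inv; exists p, (frame_vec 0 (expR b) 1); split.
- by rewrite form_frame !coord_frame_vecE; have := expR_gt0 b; lra.
- split; last by rewrite -/(cx _) cx_vec.
  by exists p; split; exists 0; rewrite // scale0r Defs.shift0.
have bb : expR b * expR (- b) = 1 by rewrite expRN mulfV // expR_neq0.
split=> // [x [t _ <-]|w].
  rewrite /= /frame_aff_fun shiftK frame_linE /frame_fun; congr (_ +! _).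
  apply: frame_vec_inj; rewrite !coord_frame_vecE !(cxZ, cyZ, cwZ) !coord_frame_vecE;
    rewrite ?mulr0 ?oppr0 //; first by ring.
  by rewrite mulrCA [expR (- b) * _]mulrC bb mulr1.
rewrite form_frame !coord_frame_vecE mulr0 add0r mulr1 => wv.
rewrite /= frame_linE /frame_fun expR0 mul1r -scaleN1r.
apply: frame_vec_inj; rewrite coord_frame_vecE coordE ?mulN1r //; first by lra.
have -> : cy w = - (expR b * cw w) by lra.
by rewrite mulrN mulrA [expR (- b) * _]mulrC bb mul1r.
Qed.

(** On timelike vectors y and w have opposite signs, and [A] replaces y by e^b w; thus [- A]
    preserves [Future], and it is its own inverse. *)
Lemma half_turn_reverses_time Future b : time_orientation B Future ->
  future_pointing B Future sm ->
  reverses_time Future (lin (frame_aff true 0 b (- b))).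
Proof.
move=> FP smP; have FE v := FutureE v FP smP.
rewrite /= /reverses_time; set A := frame_lin _ _ _ _.
have AA v : A (A v) = v.
  rewrite -comp_lfunE frame_lin_comp -3!expRD addr0 subrr addNr expR0 frame_lin1.
  by rewrite id_lfunE.
have AN v : Future v -> Future (- A v).
  move=> /FE[Tv yv]; apply/FE.
  have isoA : linear_isometry B A by apply/linear_isometry_frame_lin; lra.
  split; first by rewrite /timelike /= formNl formNr opprK isoA.
  rewrite -scaleN1r cyZ frame_linE /frame_fun coord_frame_vecE mulN1r -mulrN.
  rewrite mulr_gt0 ?expR_gt0 //.
  move: Tv; rewrite /timelike /= form_frame => Tv.
  have := sqr_ge0 (cx v); rewrite expr2 => x2.
  have : 0 < cy v * - cw v by lra.
  by rewrite pmulr_rgt0.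
apply/seteqP; split=> [_ [v Fv <-]|_ [v Fv <-]].
  by exists (- A v); [exact: AN|rewrite opprK].
by exists (- A v); [exact: AN|rewrite linearN /= AA].
Qed.

(** * The isomorphism with a semidirect product, uniformly for the three groups *)

Section Isomorphism.
Variables (n k : nat) (C : 'End(V) -> Prop).
Variables (fa fb fc : 'rV[R]_n -> R) (ra rb rc : 'rV[R]_n).
Hypotheses (fa_cont : continuous fa) (fb_cont : continuous fb) (fc_cont : continuous fc).
Hypothesis f_add : forall u v,
  [/\ fa (u + v) = fa u + fa v, fb (u + v) = fb u + fb v & fc (u + v) = fc u + fc v].
Hypothesis f_act : forall v, [/\ fa (Z2act k true v) = fa v,
  fb (Z2act k true v) = fc v & fc (Z2act k true v) = fb v].
Hypothesis fK : forall v, fa v *: ra + fb v *: rb + fc v *: rc = v.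
Hypothesis C_frame_lin : forall e a b c,
  C (frame_lin e (expR a) (expR b) (expR c)) <->
  exists v, [/\ a = fa v, b = fb v & c = fc v].

(** The functions [fa], [fb], [fc] embed R^n as the space of logarithms cut out by [C], turning the
    action of Z/2 into the exchange of b and c; the rows [ra], [rb], [rc] give a left inverse. *)
Definition frame_iso (x : semidirect R n k) : affinity E :=
  frame_aff x.2 (fa x.1) (fb x.1) (fc x.1).

(** Total on affinities, but meaningful only on the group, where the arguments of the logarithms are
    positive. *)
Definition frame_iso_inv (g : affinity E) : semidirect R n k :=
  (ln `|cx (lin g s)| *: ra + ln (cy (lin g (sm - sp))) *: rb +
   ln (cw (lin g (sm - sp))) *: rc, cx (lin g s) < 0).

Lemma frame_isoM : {morph frame_iso : x y / (x * y)%g >-> (x * y)%g}.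
Proof.
move=> [u e] [v e']; rewrite /frame_iso frame_aff_mul /=.
have [-> -> ->] := f_add u (Z2act k e v); case: e; last by rewrite Z2act_false.
by have [-> -> ->] := f_act v.
Qed.

Lemma frame_isoK : cancel frame_iso frame_iso_inv.
Proof.
move=> [v e]; rewrite /frame_iso_inv /frame_iso /=.
have [-> -> ->] := frame_lin_params e (fa v) (fb v) (fc v).
have -> : `|if e then - expR (fa v) else expR (fa v)| = expR (fa v).
  by case: e; rewrite ?normrN gtr0_norm ?expR_gt0.
rewrite !expRK fK; congr pair.
by case: e; rewrite ?oppr_lt0 ?expR_gt0 // ltNge ltW ?expR_gt0.
Qed.

Lemma range_frame_iso : range frame_iso = automorphisms C H.
Proof.
apply/seteqP; split=> [_ [[v e] _ <-]|g [Cg gH]].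
  split; last exact: frame_aff_stabilizes.
  by apply/C_frame_lin; exists v.
have [e [a [b [c gE]]]] := stabilizer_frame_aff gH; subst g.
by move: Cg => /C_frame_lin[v [-> -> ->]]; exists (v, e).
Qed.

(** The image of [u] is a combination of three fixed vectors with exponential coefficients. *)
Lemma continuous_frame_lin e u j : continuous (fun v =>
  vcoord (frame_lin e (expR (fa v)) (expR (fb v)) (expR (fc v)) u) 0 j).
Proof.
pose P := (if e then - cx u else cx u) *: s.
pose Q := (if e then cw u else cy u) *: sm.
pose S := - (if e then cy u else cw u) *: sp.
have fE v : frame_lin e (expR (fa v)) (expR (fb v)) (expR (fc v)) u =
    expR (fa v) *: P + (expR (fb v) *: Q + expR (fc v) *: S).
  rewrite frame_linE /frame_fun /frame_vec /P /Q /S addrA.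
  by case: (e); rewrite !scalerA ?mulrN ?mulNr ?scaleNr.
clearbody P Q S.
have -> : (fun v => vcoord (frame_lin e (expR (fa v)) (expR (fb v)) (expR (fc v)) u) 0 j)
  = (fun v => expR (fa v) * vcoord P 0 j + (expR (fb v) * vcoord Q 0 j +
      expR (fc v) * vcoord S 0 j)).
  by apply/funext => v; rewrite fE !vcoordP vcoordZ !mxE.
have exp_cont f w : continuous f -> continuous (fun v : 'rV[R]_n => expR (f v) * w).
  move=> fcont; apply: (@continuousMr _ _ (fun v => expR (f v))) => v.
  by apply: continuous_comp; [exact: fcont|exact: continuous_expR].
by apply: continuous_add; [|apply: continuous_add]; exact: exp_cont.
Qed.

Lemma continuous_frame_iso : continuous frame_iso.
Proof.
apply: (@continuous_comp_initial _ _ _ (@aff_coord R V E) frame_iso).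
apply: (@continuous_prod_bool 'rV[R]_n) => e.
rewrite /comp /aff_coord; apply: continuous_pair.
  apply: continuous_mx => i j; rewrite /frame_iso /=.
  under eq_fun do rewrite mxE /= passmx.vecof_delta.
  exact: continuous_frame_lin.
apply: continuous_mx => i j.
have -> : (fun v => vcoord (frame_iso (v, e) (orig E) -! orig E) i j) =
    (fun v => vcoord (p -! orig E) 0 j + vcoord (frame_lin e (expR (fa v))
       (expR (fb v)) (expR (fc v)) (orig E -! p)) 0 j).
  apply/funext => v; rewrite (ord1 i) /= /frame_aff_fun diff_shift.
  by rewrite -[p -! orig E in LHS]scale1r vcoordP [LHS]mxE [X in X + _]mxE mul1r.
by apply: continuous_add; [exact: cst_continuous|exact: continuous_frame_lin].
Qed.

Lemma continuous_frame_iso_inv : {within automorphisms C H, continuous frame_iso_inv}.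
Proof.
have cx_cont u : continuous (fun g : affinity E => cx (lin g u)) by exact: continuous_lin_form.
have cw_cont u : continuous (fun g : affinity E => cw (lin g u)) by exact: continuous_lin_form.
have cy_cont u : continuous (fun g : affinity E => cy (lin g u)).
  have -> : (fun g : affinity E => cy (lin g u)) = fun g => B (lin g u) (- sp).
    by apply/funext => g; rewrite linearNr.
  exact: continuous_lin_form.
apply: continuous_in_subspaceT => g; rewrite inE -range_frame_iso => -[[v e] _ <-].
have [xE yE wE] := frame_lin_params e (fa v) (fb v) (fc v).
apply: (@continuous_ln_sign _ _ _ (fun h => cx (lin h s)) (fun h => cy (lin h (sm - sp)))
  (fun h => cw (lin h (sm - sp)))) => //=; rewrite ?xE ?yE ?wE ?expR_gt0 //.
by case: e {xE yE wE}; rewrite ?oppr_eq0 expR_neq0.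
Qed.

Lemma isog_semidirect_frame_iso : isog_semidirect (automorphisms C H) n k.
Proof.
exists frame_iso, frame_iso_inv; split.
- exact: frame_isoM.
- exact: range_frame_iso.
- exact: frame_isoK.
- exact: continuous_frame_iso.
- exact: continuous_frame_iso_inv.
Qed.

End Isomorphism.

(* The coordinates (s, t, u) with a = s, b = u + t, c = u - t diagonalize the
   exchange of b and c; s = u on similarities, and s = u = 0 on isometries. *)
Lemma isog_GLplus : isog_semidirect (automorphisms (@GLplus R V) H) 3 1.
Proof.
pose d j : 'rV[R]_3 := delta_mx 0 j.
apply: (@isog_semidirect_frame_iso 3 1 _ (fun v => v 0 0)
  (fun v => v 0 ord_max + v 0 1) (fun v => v 0 ord_max + v 0 1 * -1)
  (d 0) (2^-1 *: (d ord_max + d 1)) (2^-1 *: (d ord_max - d 1))).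
- exact: continuous_coord.
- by apply: continuous_add; exact: continuous_coord.
- apply: continuous_add; first exact: continuous_coord.
  by apply: continuousMr; exact: continuous_coord.
- by move=> u v; rewrite !mxE; split; ring.
- by move=> v; rewrite !mxE /=; split; ring.
- move=> v; apply/rowP => j; rewrite !mxE /=.
  have j3 : j = 0 \/ j = 1 \/ j = ord_max.
    by case: j => [[|[|[|]]] h] //; [left|right; left|right; right]; exact/val_inj.
  by case: j3 => [->|[->|->]]; rewrite /=; field.
- move=> e a b c; split=> _; last exact: GLplus_frame_lin.
  exists (a *: d 0 + ((b - c) / 2) *: d 1 + ((b + c) / 2) *: d ord_max).
  by rewrite !mxE /=; split; field.
Qed.

Lemma isog_SO21xRplus : isog_semidirect (automorphisms (SO21xRplus B) H) 2 1.
Proof.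
pose d j : 'rV[R]_2 := delta_mx 0 j.
apply: (@isog_semidirect_frame_iso 2 1 _ (fun v => v 0 0)
  (fun v => v 0 0 + v 0 1) (fun v => v 0 0 + v 0 1 * -1)
  (d 0) (2^-1 *: d 1) (- 2^-1 *: d 1)).
- exact: continuous_coord.
- by apply: continuous_add; exact: continuous_coord.
- apply: continuous_add; first exact: continuous_coord.
  by apply: continuousMr; exact: continuous_coord.
- by move=> u v; rewrite !mxE; split; ring.
- by move=> v; rewrite !mxE /=; split; ring.
- move=> v; apply/rowP => j; rewrite !mxE /=.
  have j2 : j = 0 \/ j = 1.
    by case: j => [[|[|]] h] //; [left|right]; exact/val_inj.
  by case: j2 => [->|->]; rewrite /=; field.
- move=> e a b c; rewrite SO21xRplus_frame_lin; split=> [bc|[v [-> -> ->]]]; last by ring.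
  exists (a *: d 0 + (b - a) *: d 1).
  by rewrite !mxE /=; split; lra.
Qed.

(** Only the coordinate t survives, with b = t and c = -t, so the index of the negated coordinate
    drops from 1 to 0; t is recovered from b alone. *)
Lemma isog_SO21 : isog_semidirect (automorphisms (SO21 B) H) 1 0.
Proof.
apply: (@isog_semidirect_frame_iso 1 0 _ (fun=> 0) (fun v => v 0 0)
  (fun v => v 0 0 * -1) 0 (const_mx 1) 0).
- exact: cst_continuous.
- exact: continuous_coord.
- by apply: continuousMr; exact: continuous_coord.
- by move=> u v; rewrite !mxE; split; ring.
- by move=> v; rewrite !mxE /=; split; ring.
- by move=> v; apply/rowP => j; rewrite !mxE !ord1; ring.
- move=> e a b c; rewrite SO21_frame_lin; split=> [[-> bc]|[v [-> -> ->]]].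
    by exists (const_mx b); rewrite !mxE; split; lra.
  by split=> //; ring.
Qed.

Lemma involution_reflection (Future : set V) (g : affinity E) :
  time_orientation B Future -> future_pointing B Future sm ->
  involution g -> g @` H = H ->
  [/\ exists q v, [/\ 0 < B v v, orthogonal_lines B q v p s & is_reflection B g q v],
      GLplus (lin g) & reverses_time Future (lin g)].
Proof.
move=> FP smP ginv /stabilizer_frame_aff[e [a [b [c gE]]]]; subst g.
have [eE aE bc] := involution_frame_aff ginv; subst e a.
have coordE : c = - b by lra.
subst c; split; [exact: half_turn_reflection|exact: GLplus_frame_lin|].
exact: half_turn_reverses_time.
Qed.

End NullFrame.

Theorem mainTheorem2 (R : realType) (V : vectType R) (dimV : \dim {:V} = 3%N)
    (B : {symmetric V}) (sigB : signature21 B)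
    (b : 3.-tuple V) (orientation : basis_of {:V} b)
    (Future : set V) (FutureP : time_orientation B Future)
    (E : affineSpace V) (p : E) (s sm sp : V)
    (frame : null_frame B b Future s sm sp) :
  let H := crooked_halfspace B p s sm sp in
  [/\ isog_semidirect (automorphisms (@GLplus R V) H) 3 1,
      isog_semidirect (automorphisms (SO21xRplus B) H) 2 1,
      isog_semidirect (automorphisms (SO21 B) H) 1 0
    & forall g : affinity E, involution g -> g @` H = H ->
        [/\ exists (q : E) (v : V),
              [/\ 0 < B v v, orthogonal_lines B q v p s
                & is_reflection B g q v],
            GLplus (lin g)
          & reverses_time Future (lin g)]].
Proof.
case: frame => Bss [Bms Bmm smF] [Bps Bpp _] Bmp _ /=; split.
- exact: isog_GLplus.
- exact: isog_SO21xRplus.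
- exact: isog_SO21.
- by move=> g ginv gH; exact: involution_reflection gH.
Qed.
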